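(* For any positive integer $n$ there holds $$\det_{\sigma,\pi\in\mathfrak S_n}\Big(q^{\operatorname{maj}(\sigma\pi^{-1})}\Big)=\prod_{i=2}^{n}(1-q^{i})^{n!\,(i-1)/i},$$ where $q$ is an indeterminate and rows and columns are indexed by the permutations of the symmetric group $\mathfrak S_n$ (in the same order).
   Context: For a permutation $\pi=\pi_1\pi_2\cdots\pi_n$ of $\{1,\dots,n\}$, the major index $\operatorname{maj}(\pi)$ is the sum of all positions $i\in\{1,\dots,n-1\}$ with $\pi_i>\pi_{i+1}$ (descents). *)

(* Defs.v *)
From mathcomp Require Import all_boot all_order all_algebra all_fingroup.

Set Implicit Arguments.
Unset Strict Implicit.
Unset Printing Implicit Defensive.

(* The word pi_1 pi_2 ... pi_n with letters in {1, ..., n}: the letter pi_k is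
   stored at index k.-1, since 'I_n is {0, ..., n - 1}. *)
Definition one_line (n : nat) (p : 'S_n) : seq nat :=
  [seq (val (p k)).+1 | k <- enum 'I_n].

Definition maj (n : nat) (p : 'S_n) : nat :=
  \sum_(1 <= i < n | nth 0 (one_line p) i.-1 > nth 0 (one_line p) i) i.

(* Product of permutations as composition of functions, x |-> s (t x); the
   MathComp group law on 'S_n composes in the opposite order. *)
Definition perm_comp (n : nat) (s t : 'S_n) : 'S_n := (t * s)%g.

(* The matrix (q^maj(sigma pi^-1)) over Z[q], q = 'X, with both rows and columns
   listed in the order e. *)
Definition maj_matrix (n : nat) (e : 'I_(n`!) -> 'S_n) : 'M[{poly int}]_(n`!) :=
  (\matrix_(i, j) 'X^(maj (perm_comp (e i) (e j)^-1%g)))%R.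

(* Main.v *)
Require Import Defs.
From mathcomp Require Import all_boot all_order all_algebra all_fingroup.
From mathcomp Require Import zify.

Set Implicit Arguments.
Unset Strict Implicit.
Unset Printing Implicit Defensive.

Import GRing.Theory.
Local Open Scope ring_scope.

(* Let c_k be the cycle v |-> v - 1 mod k on the k smallest letters. If g fixes
   all letters >= k, then rotating the letters of g by c_k^j with j < k raises
   maj by exactly j; hence in the group algebra
     sum_g q^maj(g) g = F_n ... F_2,   F_k = sum_(j < k) q^j c_k^j.
   In the regular representation F_k (1 - q c_k) = 1 - q^k. Replacing, in the
   matrix 1 - q c_k, the column of one element of each c_k-orbit by the identity
   column makes both that matrix and its product with F_k triangular for suitable
   orders, and det F_k = (1 - q^k)^(n! - n!/k) is read off the diagonals. *)

(** * Triangularity without a linear order on the indices *)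

(** If [s] contributes to the expansion, then [lev i <= lev (s i)] for all [i]. Both sides have the
    same sum over [i], so all these are equalities and [s] is the identity. *)
Lemma det_trig_level (R : comNzRingType) (N : nat) (A : 'M[R]_N)
    (lev : 'I_N -> nat) :
  (forall i j, A i j != 0 -> i = j \/ (lev i < lev j)%N) ->
  \det A = \prod_i A i i.
Proof.
move=> trigA; rewrite /determinant (bigD1 1%g) //= odd_perm1 mul1r.
rewrite [X in _ + X]big1 ?addr0 => [|s s_neq1].
  by apply: eq_bigr => i _; rewrite perm1.
have [/forallP nzA|] := boolP [forall i, A i (s i) != 0]; last first.
  rewrite negb_forall => /existsP[i /negPn/eqP Ai0].
  by rewrite (bigD1 i) //= Ai0 mul0r mulr0.
have le_lev i : (lev i <= lev (s i))%N.
  by case: (trigA _ _ (nzA i)) => [<-|/ltnW].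
have [_ /esym eq_lev] := leqif_sum (fun i (_ : true) => leqif_eq (le_lev i)).
have sum_lev : (\sum_i lev (s i) = \sum_i lev i)%N.
  by rewrite [RHS](reindex_inj (@perm_inj _ s)).
rewrite sum_lev eqxx in eq_lev.
case/eqP: s_neq1; apply/permP => i; rewrite perm1.
move/forallP/(_ i): eq_lev => /= /eqP lev_i.
by case: (trigA _ _ (nzA i)) => [//|]; rewrite -lev_i ltnn.
Qed.

(** * Geometric sums in the regular representation *)

(** Right multiplication by [g], acting on columns. It reverses the MathComp product, hence respects
    [perm_comp]. *)
Definition regular_mx (R : comNzRingType) (gT : finGroupType) (N : nat)
    (e : 'I_N -> gT) (g : gT) : 'M[R]_N :=
  \matrix_(i, j) (e i == (e j * g)%g)%:R.

Lemma regular_mx1 (R : comNzRingType) (gT : finGroupType) (N : nat)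
    (e : 'I_N -> gT) : injective e -> regular_mx R e 1 = 1%:M.
Proof.
by move=> e_inj; apply/matrixP => i j; rewrite !mxE mulg1 (inj_eq e_inj).
Qed.

Lemma regular_mxM (R : comNzRingType) (gT : finGroupType) (N : nat)
    (e : 'I_N -> gT) (g h : gT) : bijective e ->
  regular_mx R e g *m regular_mx R e h = regular_mx R e (h * g)%g.
Proof.
move=> [e' eK e'K]; apply/matrixP => i k; rewrite !mxE.
rewrite (bigD1 (e' (e k * h)%g)) //= !mxE e'K eqxx mulr1 mulgA.
rewrite big1 ?addr0 // => j; rewrite !mxE [e j == _](can2_eq eK e'K) => /negPf->.
by rewrite mulr0.
Qed.

Definition geom_mx (R : comNzRingType) (gT : finGroupType) (N : nat)
    (e : 'I_N -> gT) (q : R) (c : gT) (k : nat) : 'M[R]_N :=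
  \sum_(j < k) q ^+ j *: regular_mx R e (c ^+ j)%g.

Lemma geom_mx_mul (R : comNzRingType) (gT : finGroupType) (N : nat)
    (e : 'I_N -> gT) (q : R) (c : gT) (k : nat) :
  bijective e -> (c ^+ k)%g = 1%g ->
  geom_mx e q c k *m (1%:M - q *: regular_mx R e c) = (1 - q ^+ k)%:M.
Proof.
move=> e_bij ck1; have e_inj := bij_inj e_bij.
pose u j := q ^+ j *: regular_mx R e (c ^+ j)%g.
rewrite mulmxBr mulmx1 -scalemxAr mulmx_suml scaler_sumr /geom_mx -sumrB.
rewrite (eq_bigr (fun j : 'I_k => - (u j.+1 - u j))) => [|j _].
  rewrite sumrN -(big_mkord xpredT (fun j => u j.+1 - u j)) telescope_sumr //.
  rewrite opprB /u ck1 expg0 expr0 regular_mx1 // scale1r.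
  by rewrite -[(1 - _)%:M]scalemx1 scalerBl scale1r.
by rewrite opprB /u -scalemxAl regular_mxM // -expgS scalerA -exprS.
Qed.

Lemma level_expg (gT : finGroupType) (v : gT -> nat) (c : gT) (k : nat) :
  (forall g, v (g * c)%g = if v g is a.+1 then a else k) ->
  forall g l, v g = k -> (l <= k)%N -> v (g * c ^+ l)%g = (k - l)%N.
Proof.
move=> vc g l vg; elim: l => [|l IHl] lt_lk; first by rewrite mulg1 vg subn0.
rewrite expgSr mulgA vc IHl ?(ltnW lt_lk) // subnS.
by case: (k - l)%N (subn_gt0 l k) => [|//]; rewrite lt_lk.
Qed.

(** Right multiplication by [c] carries each level bijectively onto the next, so the [k.+1] levels
    have equal size and the division is exact. *)
Lemma card_level (gT : finGroupType) (v : gT -> nat) (c : gT) (k : nat) :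
  (forall g, v g <= k)%N ->
  (forall g, v (g * c)%g = if v g is a.+1 then a else k) ->
  #|[pred g | v g != k]| = ((#|gT| * k) %/ k.+1)%N.
Proof.
move=> v_le vc.
have card_eq a : (a <= k)%N ->
    #|[pred g | v g == (k - a)%N]| = #|[pred g | v g == k]|.
  elim: a => [|a IHa] lt_ak; first by rewrite subn0.
  rewrite -IHa 1?ltnW // -!sum1_card (reindex_inj (mulIg c)) /=.
  apply: eq_bigl => g; rewrite !inE vc; have := v_le g.
  by case: (v g) => [|b]; lia.
have cardT : #|gT| = (k.+1 * #|[pred g | v g == k]|)%N.
  pose f g : 'I_k.+1 := inord (k - v g).
  rewrite -sum1_card (partition_big f xpredT) //=.
  rewrite -[X in (X * _)%N](card_ord k.+1) -sum_nat_const; apply: eq_bigr => a _.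
  rewrite -(card_eq a) -?sum1_card; last exact: ltn_ord a.
  apply: eq_bigl => g; rewrite inE -val_eqE /= inordK ?ltnS ?leq_subr //.
  have := v_le g; have := ltn_ord a; lia.
have := cardC [pred g | v g == k]; rewrite cardT -mulnA mulKn // => /eqP.
rewrite mulSn eqn_add2l mulnC => /eqP <-.
by apply: eq_card => g; rewrite !inE.
Qed.

(** The elements of level [k] are the representatives of the orbits of [c]. Since [U] has
    determinant 1, the determinant sought is that of the product [L], and nothing has to be
    cancelled in [R]. *)
Lemma det_geom_mx (R : comNzRingType) (gT : finGroupType) (N : nat)
    (e : 'I_N -> gT) (q : R) (c : gT) (v : gT -> nat) (k : nat) :
  bijective e -> (c ^+ k.+1)%g = 1%g ->
  (forall g, v g <= k)%N ->
  (forall g, v (g * c)%g = if v g is a.+1 then a else k) ->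
  \det (geom_mx e q c k.+1) = (1 - q ^+ k.+1) ^+ ((#|gT| * k) %/ k.+1).
Proof.
move=> e_bij ck1 v_le vc; have e_inj := bij_inj e_bij.
pose top (j : 'I_N) := v (e j) == k.
pose U : 'M[R]_N := \matrix_(i, j)
  if top j then (i == j)%:R else (1%:M - q *: regular_mx R e c) i j.
pose L : 'M[R]_N := \matrix_(i, j)
  if top j then geom_mx e q c k.+1 i j else (1 - q ^+ k.+1)%:M i j.
have FU : geom_mx e q c k.+1 *m U = L.
  apply/matrixP => i j; rewrite !mxE; case: ifP => tj.
    rewrite (bigD1 j) //= !mxE tj eqxx mulr1 big1 ?addr0 // => l /negPf lj.
    by rewrite !mxE tj lj mulr0.
  move/matrixP/(_ i j): (geom_mx_mul q e_bij ck1); rewrite !mxE => <-.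
  by apply: eq_bigr => l _; rewrite [U l j]mxE tj.
have detU : \det U = 1.
  (* Off the diagonal, a column that is not top has only the entry [- q], in the row of [e j * c],
     one level lower. From level 0 this row is a top one; hence top elements are put below all
     others. *)
  rewrite (@det_trig_level R N U (fun i => if top i then 0 else (v (e i)).+1)%N).
    apply: big1 => i _; rewrite !mxE eqxx; case: ifPn => // nti.
    suff /negPf->: e i != (e i * c)%g by rewrite mulr0 subr0.
    apply: contraNneq nti => /(congr1 v); rewrite vc /top.
    by case: (v (e i)) => [->|a /eqP]; rewrite ?eqxx //; lia.
  move=> i j; rewrite !mxE; case: (eqVneq i j) => [|_]; first by left.
  case: ifPn => [|ntj]; first by rewrite eqxx.
  case: (eqVneq (e i) _) => [ei _|]; last by rewrite mulr0 subrr eqxx.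
  right; rewrite /top ei vc; case: (v (e j)) => [|a]; first by rewrite eqxx.
  by case: ifP.
have detL : \det L = (1 - q ^+ k.+1) ^+ #|[pred j | ~~ top j]|.
  have geomE i j : geom_mx e q c k.+1 i j
      = \sum_(l < k.+1) q ^+ l * (e i == (e j * c ^+ l)%g)%:R.
    by rewrite summxE; apply: eq_bigr => l _; rewrite !mxE.
  (* In a top column the power [c ^+ l] leads to level [k - l], so only [l = 0] meets the diagonal,
     with entry 1. *)
  rewrite (@det_trig_level R N L (fun i => v (e i))).
    rewrite -prodr_const [RHS]big_mkcond; apply: eq_bigr => i _ /=.
    rewrite !mxE inE; case: ifPn => [ti|nti] /=; last by rewrite eqxx mulr1n.
    rewrite geomE big_ord_recl /= expg0 mulg1 eqxx expr0 mulr1 big1 ?addr0 // => l _.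
    suff /negPf->: e i != (e i * c ^+ lift ord0 l)%g by rewrite mulr0.
    apply/eqP => /(congr1 v).
    rewrite (level_expg vc (eqP ti)) ?(eqP ti) /= /bump /=.
      by have := ltn_ord l; lia.
    exact: ltn_ord l.
  move=> i j; rewrite !mxE; case: ifPn => [tj|ntj]; last first.
    by case: (eqVneq i j) => [|_]; [left|rewrite mulr0n eqxx].
  rewrite geomE => nz.
  have [l /eqP eil|none] := pickP (fun l : 'I_k.+1 => e i == (e j * c ^+ l)%g).
    rewrite eil (level_expg vc (eqP tj)) ?(eqP tj); last exact: ltn_ord l.
    case: (posnP l) => [l0|l_gt0]; last by right; have := ltn_ord l; lia.
    by left; apply: e_inj; rewrite eil l0 mulg1.
  by case/eqP: nz; apply: big1 => l _; rewrite none mulr0.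
rewrite -[LHS]mulr1 -[X in _ * X]detU -det_mulmx FU detL; congr (_ ^+ _).
rewrite -(card_level v_le vc) -!sum1_card.
by rewrite (reindex e) //; apply: onW_bij.
Qed.

(** * Cycles on the smallest letters *)

Definition cyc_fun (n : nat) (m v : 'I_n) : 'I_n :=
  if v == 0%N :> nat then m
  else if (v <= m)%N then Ordinal (leq_ltn_trans (leq_pred v) (ltn_ord v))
  else v.

Lemma cyc_fun_inj (n : nat) (m : 'I_n) : injective (cyc_fun m).
Proof.
move=> u v /(congr1 val) eq_uv; apply: val_inj; move: eq_uv; rewrite /cyc_fun /=.
by do ![case: ifP => /=]; lia.
Qed.

(* The cycle v |-> v - 1 mod (m + 1) on the values {0, ..., m}. *)
Definition cyc (n : nat) (m : 'I_n) : 'S_n := perm (@cyc_fun_inj n m).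

Lemma cycE (n : nat) (m v : 'I_n) :
  cyc m v = (if v == 0%N :> nat then nat_of_ord m else if v <= m then v.-1 else v)%N :> nat.
Proof. by rewrite permE /cyc_fun; do ![case: ifP]. Qed.

Lemma cyc_expg_low (n : nat) (m v : 'I_n) (j : nat) :
  (j <= v <= m)%N -> (cyc m ^+ j)%g v = (v - j)%N :> nat.
Proof.
elim: j => [|j IHj] bnd; first by rewrite expg0 perm1 subn0.
rewrite expgSr permM cycE IHj; last by lia.
by do ![case: ifP]; lia.
Qed.

Lemma cyc_expg_high (n : nat) (m v : 'I_n) (j : nat) :
  (m < v)%N -> (cyc m ^+ j)%g v = v.
Proof.
move=> ltmv; elim: j => [|j IHj]; first by rewrite expg0 perm1.
by apply: val_inj; rewrite /= expgSr permM cycE IHj; do ![case: ifP]; lia.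
Qed.

Lemma cyc_order (n : nat) (m : 'I_n) : (cyc m ^+ m.+1)%g = 1%g.
Proof.
apply/permP => v; rewrite perm1; case: (ltnP m v) => [|le_vm].
  exact: cyc_expg_high.
(* From [v], [v] steps lead down to 0, one step jumps to [m], and [m - v] steps return to [v]. *)
have -> : m.+1 = (v + 1 + (m - v))%N by lia.
rewrite !expgD expg1 !permM; apply: val_inj => /=.
have -> : cyc m ((cyc m ^+ v)%g v) = m.
  by apply: val_inj; rewrite /= cycE cyc_expg_low ?subnn ?leqnn.
by rewrite cyc_expg_low; lia.
Qed.

(* The first position carrying a letter at most m is unchanged by the cycle on
   values, so the letter found there moves around the cycle. *)
Definition low_letter (n : nat) (m : 'I_n) (g : 'S_n) : nat :=
  if [pick x | (g x <= m)%N] is Some x then g x else 0%N.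

Lemma low_letter_le (n : nat) (m : 'I_n) (g : 'S_n) : (low_letter m g <= m)%N.
Proof. by rewrite /low_letter; case: pickP. Qed.

Lemma low_letter_cyc (n : nat) (m : 'I_n) (g : 'S_n) :
  low_letter m (g * cyc m)%g = if low_letter m g is a.+1 then a else m.
Proof.
rewrite /low_letter (eq_pick (Q := fun x => (g x <= m)%N)) => [|x]; last first.
  by rewrite permM cycE; do ![case: ifP]; lia.
(* The letter [m] occurs somewhere, so the default 0 is never reached. *)
case: pickP => [x le_m|none]; last by have := none (g^-1%g m); rewrite permKV leqnn.
by rewrite permM cycE le_m; case: (nat_of_ord (g x)).
Qed.

(** * The major index under rotation of the letters *)

Lemma nth_one_line (n : nat) (p : 'S_n) (x : 'I_n) :
  nth 0%N (one_line p) x = (p x).+1.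
Proof. by rewrite (nth_map x) ?size_enum_ord // nth_ord_enum. Qed.

(** Here [i] is the position counted from 1, so the letters compared have indices [i.-1] and [i].
    Being a boolean factor, it allows two major indices to be compared term by term. *)
Definition desc (n : nat) (p : 'S_n) (i : nat) : bool :=
  (nth 0 (one_line p) i < nth 0 (one_line p) i.-1)%N.

Lemma descE (n : nat) (p : 'S_n) (i : nat) (lt_i : (i < n)%N)
    (lt_i1 : (i.-1 < n)%N) :
  desc p i = (p (Ordinal lt_i) < p (Ordinal lt_i1))%N.
Proof.
by rewrite /desc (nth_one_line p (Ordinal lt_i)) (nth_one_line p (Ordinal lt_i1)).
Qed.

Lemma majE (n : nat) (p : 'S_n) : maj p = (\sum_(1 <= i < n) desc p i * i)%N.
Proof.
rewrite /maj big_mkcond; apply: eq_bigr => i _; rewrite /desc.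
by case: ifP; rewrite ?mul1n.
Qed.

Lemma maj1 (n : nat) : maj (1%g : 'S_n) = 0%N.
Proof.
rewrite majE big_nat_cond big1 // => i /andP[/andP[i_gt0 lt_in] _].
by rewrite (descE _ lt_in (leq_ltn_trans (leq_pred i) lt_in)) !perm1 /=; case: ltnP => //; lia.
Qed.

Definition fixes_above (n : nat) (m : nat) : {set 'S_n} :=
  [set g : 'S_n | [forall x : 'I_n, (m < x)%N ==> (g x == x)]].

Lemma fixes_aboveP (n m : nat) (g : 'S_n) :
  reflect (forall x : 'I_n, (m < x)%N -> g x = x) (g \in fixes_above n m).
Proof.
rewrite inE; apply: (iffP forallP) => [gP x|gP x]; last by apply/implyP => /gP->.
by move/implyP: (gP x) => gx /gx/eqP.
Qed.

Lemma fixes_above_le (n : nat) (m : 'I_n) (g : 'S_n) (x : 'I_n) :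
  g \in fixes_above n m -> (x <= m)%N -> (g x <= m)%N.
Proof.
move=> /fixes_aboveP gP le_xm; case: leqP => // lt_m.
by have /perm_inj gx := gP _ lt_m; rewrite gx ltnNge le_xm in lt_m.
Qed.

(* If the letter 0 sits at index a < m, the descent at a (present unless a = 0)
   is replaced by a descent at a + 1. *)
Lemma maj_cyc (n : nat) (m : 'I_n) (g : 'S_n) :
  g \in fixes_above n m -> g m != 0%N :> nat ->
  maj (g * cyc m)%g = (maj g).+1.
Proof.
move=> gH gm0; have n_gt0 : (0 < n)%N by apply: leq_ltn_trans (ltn_ord m).
pose a := (g^-1 (Ordinal n_gt0))%g.
have ga : g a = 0%N :> nat by rewrite permKV.
have g0 x : g x = 0%N :> nat -> x = a.
  by move=> gx; apply: (@perm_inj _ g); apply: val_inj; rewrite /= gx ga.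
(* Thus index [a.+1] still carries a letter at most [m], and the new letter [m] at [a] makes a
   descent there. *)
have lt_am : (a < m)%N.
  case: (ltngtP a m) => // [lt_ma|/val_inj am]; last by rewrite -am ga in gm0.
  by move/fixes_aboveP/(_ _ lt_ma): gH => /(congr1 val) /=; rewrite ga; lia.
have sum_pick b : (b < n)%N -> (\sum_(1 <= i < n) (i == b) * i = b)%N.
  move=> lt_bn; transitivity (\sum_(0 <= i < n) (i == b) * i)%N.
    by rewrite [RHS]big_ltn // muln0.
  rewrite big_mkord (bigD1 (Ordinal lt_bn)) //= eqxx mul1n big1 ?addn0 // => i.
  by rewrite -val_eqE /= => /negPf->.
(* With [a] and [a.+1] written as sums, the equality holds for each [i]: the new descent indicator
   plus [i == a] is the old one plus [i == a.+1]. *)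
suff: (maj (g * cyc m)%g + a = maj g + a.+1)%N by lia.
rewrite !majE -{1}(sum_pick a (ltn_ord a)) -(sum_pick a.+1); last by have := ltn_ord m; lia.
rewrite -!big_split /= !big_nat; apply: eq_bigr => i /andP[i_gt0 lt_in].
rewrite -!mulnDl; congr (_ * _)%N.
have lt_i1 := leq_ltn_trans (leq_pred i) lt_in.
rewrite !(descE _ lt_in lt_i1) !permM !cycE.
set x := Ordinal lt_in; set y := Ordinal lt_i1.
have gx0 : (g x == 0%N :> nat) = (i == a).
  by apply/eqP/eqP => [/g0/(congr1 val) //|ia]; rewrite -ga; congr (val (g _)); apply: val_inj.
have gy0 : (g y == 0%N :> nat) = (i == a.+1).
  apply/eqP/eqP => [/g0/(congr1 val) /=|ia]; first by lia.
  by rewrite -ga; congr (val (g _)); apply: val_inj; rewrite /= ia.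
have gx : if (i <= m)%N then (g x <= m)%N else g x == i :> nat.
  case: ifPn => [|lt_mi]; first exact: (@fixes_above_le n m g x gH).
  by move/fixes_aboveP: gH => -> /=; rewrite ?eqxx ?ltnNge.
have gy : if (i.-1 <= m)%N then (g y <= m)%N else g y == i.-1 :> nat.
  case: ifPn => [|lt_mi]; first exact: (@fixes_above_le n m g y gH).
  by move/fixes_aboveP: gH => -> /=; rewrite ?eqxx ?ltnNge.
have gxy : g x != g y :> nat.
  by apply/eqP => /val_inj/perm_inj/(congr1 val) /=; lia.
move: gx gy gx0 gy0 gxy.
move: (nat_of_ord (g x)) (nat_of_ord (g y)) (nat_of_ord a) (nat_of_ord m) lt_am.
move=> X Y A M lt_AM.
case: (leqP i M) => iM; case: (leqP i.-1 M) => i1M;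
  case: (X =P 0%N) => X0; case: (Y =P 0%N) => Y0;
  case: (leqP X M) => XM; case: (leqP Y M) => YM gx gy;
  do 2![case: eqP => ? // _]; move=> /eqP XY;
  case: (ltnP X Y) => ?; case: ltnP => ? /=; lia.
Qed.

(** After [i < j] steps the letter at index [m] is [m - i], which is positive, so [maj_cyc] applies
    each time. *)
Lemma maj_cyc_expg (n : nat) (m : 'I_n) (g : 'S_n) (j : nat) :
  g \in fixes_above n m -> g m = m -> (j <= m)%N ->
  maj (g * cyc m ^+ j)%g = (maj g + j)%N.
Proof.
move=> gH gm; elim: j => [|j IHj] lt_jm; first by rewrite mulg1 addn0.
rewrite expgSr mulgA maj_cyc ?IHj ?addnS 1?ltnW //.
  by apply/fixes_aboveP => x lt_mx; rewrite permM (fixes_aboveP _ _ gH) ?cyc_expg_high.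
by rewrite permM gm cyc_expg_low; lia.
Qed.

(** * Factorization of the matrix and the final determinant *)

Definition maj_part (R : comNzRingType) (n N : nat) (e : 'I_N -> 'S_n) (q : R)
    (m : nat) : 'M[R]_N :=
  \sum_(g in fixes_above n m) q ^+ maj g *: regular_mx R e g.

(** Each permutation of the letters up to [m] is uniquely [h * cyc m ^+ j] with [h] fixing [m] and
    [j <= m]. The cycle factor stands on the left because [regular_mx] reverses products. *)
Lemma maj_partS (R : comNzRingType) (n N : nat) (e : 'I_N -> 'S_n) (q : R)
    (k : nat) (m : 'I_n) :
  bijective e -> m = k.+1 :> nat ->
  maj_part e q m = geom_mx e q (cyc m) m.+1 *m maj_part e q k.
Proof.
move=> e_bij mk; rewrite /maj_part.
(* The exponent [j] is read off from the image of [m], as [cyc m ^+ j] sends [m] to [m - j]. *)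
rewrite (partition_big (fun g : 'S_n => inord (m - g m) : 'I_m.+1) xpredT) //=.
rewrite mulmx_suml; apply: eq_bigr => j _; rewrite mulmx_sumr.
have le_jm : (j <= m)%N by rewrite -ltnS.
rewrite (reindex_onto (fun g => g * cyc m ^+ j)%g (fun g => g * (cyc m ^+ j)^-1)%g) /=;
  last by move=> g _; rewrite mulgKV.
have fixP g : (g \in fixes_above n k) = (g \in fixes_above n m) && (g m == m).
  apply/fixes_aboveP/andP => [gP|[/fixes_aboveP gP /eqP gm] x lt_kx].
    split; last by rewrite gP ?mk.
    by apply/fixes_aboveP => x lt_mx; apply: gP; lia.
  by case: (ltngtP m x) => [/gP //||/val_inj <- //]; lia.
rewrite (eq_bigl [in fixes_above n k]) => [|g].
  apply: eq_bigr => g; rewrite fixP => /andP[gH /eqP gm].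
  by rewrite maj_cyc_expg // -scalemxAl -scalemxAr regular_mxM // scalerA addnC exprD.
rewrite mulgK eqxx andbT fixP.
have -> : ((g * cyc m ^+ j)%g \in fixes_above n m) = (g \in fixes_above n m).
  apply/fixes_aboveP/fixes_aboveP => gP x lt_mx; last first.
    by rewrite permM gP ?cyc_expg_high.
  by apply: (@perm_inj _ (cyc m ^+ j)%g); rewrite -permM gP ?cyc_expg_high.
case gH: (g \in _) => //=.
have gj_le : ((g * cyc m ^+ j)%g m <= m)%N.
  apply: fixes_above_le => //; apply/fixes_aboveP => x lt_mx.
  by rewrite permM (fixes_aboveP _ _ gH) ?cyc_expg_high.
rewrite -val_eqE /= inordK ?ltnS ?leq_subr //; apply/eqP/eqP => [eq_j|gm].
  apply: (@perm_inj _ (cyc m ^+ j)%g); apply: val_inj => /=.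
  by rewrite [RHS]cyc_expg_low ?le_jm ?leqnn // -permM -[in RHS]eq_j subKn.
by rewrite permM gm cyc_expg_low; lia.
Qed.

Lemma maj_part0 (R : comNzRingType) (n N : nat) (e : 'I_N -> 'S_n) (q : R) :
  injective e -> maj_part e q 0 = 1%:M.
Proof.
move=> e_inj; rewrite /maj_part (big_pred1 1%g) => [|g].
  by rewrite maj1 expr0 scale1r regular_mx1.
apply/fixes_aboveP/eqP => [gP|-> x _]; last by rewrite perm1.
apply/permP => x; rewrite perm1; case: (posnP x) => [x0|/gP //].
case: (posnP (g x)) => [gx0|/gP /perm_inj //].
by apply: val_inj; rewrite /= gx0 x0.
Qed.

Lemma det_maj_part (R : comNzRingType) (n N : nat) (e : 'I_N -> 'S_n) (q : R)
    (m : nat) : bijective e -> (m < n)%N ->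
  \det (maj_part e q m)
  = \prod_(2 <= i < m.+2) (1 - q ^+ i) ^+ ((n`! * i.-1) %/ i).
Proof.
move=> e_bij; elim: m => [|m IHm] lt_mn.
  by rewrite maj_part0 ?det1 ?big_geq //; apply: bij_inj.
rewrite big_nat_recr //= -IHm 1?ltnW // mulrC.
rewrite (@maj_partS R n N e q m (Ordinal lt_mn)) // det_mulmx; congr (_ * _).
rewrite (@det_geom_mx R _ N e q _ (low_letter (Ordinal lt_mn))) //.
- by rewrite card_Sn.
- exact: cyc_order.
- exact: low_letter_le.
- exact: low_letter_cyc.
Qed.

Theorem theorem56 (n : nat) (n_gt0 : (0 < n)%N)
    (e : 'I_(n`!) -> 'S_n) (e_bij : bijective e) :
  \det (maj_matrix e) =
  \prod_(2 <= i < n.+1) (1 - 'X^i) ^+ ((n`! * i.-1) %/ i) :> {poly int}.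
Proof.
have -> : maj_matrix e = maj_part e 'X n.-1.
  (* Only [g = (e j)^-1 * e i] contributes to the entry, and this is [perm_comp (e i) (e j)^-1]. No
     letter exceeds [n.-1], so the sum runs over the whole group. *)
  apply/matrixP => i j; rewrite /maj_part summxE mxE.
  rewrite (bigD1 ((e j)^-1 * e i)%g) /=; last first.
    by apply/fixes_aboveP => x; have := ltn_ord x; lia.
  rewrite !mxE mulKVg eqxx mulr1 big1 ?addr0 // => g /andP[_ g_neq].
  rewrite !mxE; case: eqP => [eij|]; last by rewrite mulr0.
  by rewrite eij mulKg eqxx in g_neq.
by rewrite det_maj_part //; rewrite prednK.
Qed.
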